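(* Let $p=yu+z^2$, $v=xz+yp$, $w=x^2u-2xzp-yp^2$ in $\mathbb{C}[x][y,z,u]$. If $Q = x^2Q_1 + xvQ_2$ for some $Q_1 \in \mathbb{C}[x][v,w]$ and $Q_2 \in \mathbb{C}[v^2,w]$, then the Vénéreau-type polynomial $y+xQ$ is a $\mathbb{C}[x]$-coordinate of $\mathbb{C}[x][y,z,u]$.
   Context: For a commutative ring $A$ with one, $A^{[n]}$ denotes the polynomial ring in $n$ variables over $A$. A polynomial $f\in A^{[n]}$ is an $A$-coordinate if there exist $f_2,\ldots,f_n\in A^{[n]}$ with $A[f,f_2,\ldots,f_n]=A^{[n]}$. A Vénéreau-type polynomial is a polynomial in $\mathbb{C}[x][y,z,u]$ of the form $y+xQ$ with $Q\in\mathbb{C}[x][v,w]$. *)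

(* Defs.v *)
From HB Require Import structures.
From mathcomp Require Export all_boot all_order all_algebra.
From mathcomp Require Export reals complex mpoly.

Set Implicit Arguments.
Unset Strict Implicit.
Unset Printing Implicit Defensive.

Import GRing.Theory.
Local Open Scope ring_scope.

(* b \in A[g_1, ..., g_k], the A-subalgebra of B generated by the g_i, where B
   is an A-algebra through the structure morphism iota. *)
Definition in_gen_subalg (A B : comNzRingType) (iota : {rmorphism A -> B})
    (k : nat) (g : k.-tuple B) (b : B) : Prop :=
  exists h : {mpoly A[k]}, b = mmap iota (tnth g) h.

(* The number of variables is n.+1 >= 1, and fs = (f_2, ..., f_(n+1)); the
   inclusion of A[f, f_2, ..., f_(n+1)] in the polynomial ring is automatic. *)
Definition is_coordinate (A : comNzRingType) (n : nat)
    (f : {mpoly A[n.+1]}) : Prop :=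
  exists fs : n.-tuple {mpoly A[n.+1]},
    forall g : {mpoly A[n.+1]},
      in_gen_subalg (@mpolyC n.+1 A) [tuple of f :: fs] g.

Section Venereau.

Variable K : comNzRingType.

(* K[x][y, z, u]: the coefficient ring K[x] is {poly K}. *)
Definition ven_x : {mpoly {poly K}[3]} := 'X%:MP_[3].
Definition ven_y : {mpoly {poly K}[3]} := 'X_(@Ordinal 3 0 isT).
Definition ven_z : {mpoly {poly K}[3]} := 'X_(@Ordinal 3 1 isT).
Definition ven_u : {mpoly {poly K}[3]} := 'X_(@Ordinal 3 2 isT).

Definition ven_p : {mpoly {poly K}[3]} := ven_y * ven_u + ven_z ^+ 2.

Definition ven_v : {mpoly {poly K}[3]} := ven_x * ven_z + ven_y * ven_p.

Definition ven_w : {mpoly {poly K}[3]} :=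
  ven_x ^+ 2 * ven_u - 2%:R * ven_x * ven_z * ven_p - ven_y * ven_p ^+ 2.

Definition cst_Kx : {rmorphism {poly K} -> {mpoly {poly K}[3]}} :=
  @mpolyC 3 {poly K}.

Definition cst_K : {rmorphism K -> {mpoly {poly K}[3]}} :=
  @mpolyC 3 {poly K} \o polyC.

End Venereau.

(* Main.v *)
(** Put [f = y + x^2 a] with [a = v Q2(v^2, w) + x Q1], keep [w], and replace
    [v] by [v' = v + x^2 b] with [b = - w Q2(- f w, w) / 2].  Since
    [y w + v^2 = x^2 p], the element [v^2 + f w] is a multiple of [x^2], so
    [Q2(v^2, w)] and [Q2(- f w, w)] agree modulo [x^2]; hence
    [p' = (f w + v'^2) / x^2] is a polynomial, congruent to [p] modulo [x].
    Then [z' = (v' - f p') / x] and [u' = (w + 2 v' p' - f p'^2) / x^2] are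
    polynomials as well, and [f, z', u'] generate: the inverse substitution has
    the same shape, with the signs of the three corrections reversed. *)

Require Import Defs.
From mathcomp Require Import ring.

Set Implicit Arguments.
Unset Strict Implicit.
Unset Printing Implicit Defensive.

Import GRing.Theory.
Local Open Scope ring_scope.

(** A propositional predicate, because membership in a generated subalgebra is an existential
    statement. *)
Definition is_subring (B : comNzRingType) (S : B -> Prop) : Prop :=
  [/\ S 1, forall a b, S a -> S b -> S (a - b)
    & forall a b, S a -> S b -> S (a * b)].

Section Subring.

Variables (B : comNzRingType) (S : B -> Prop).
Hypothesis ringS : is_subring S.

Lemma subring1 : S 1. Proof. by case: ringS. Qed.

Lemma subringB a b : S a -> S b -> S (a - b).
Proof. by case: ringS => _ + _; apply. Qed.

Lemma subringM a b : S a -> S b -> S (a * b).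
Proof. by case: ringS => _ _; apply. Qed.

Lemma subring0 : S 0.
Proof. by rewrite -(subrr 1); apply: subringB; apply: subring1. Qed.

Lemma subringN a : S a -> S (- a).
Proof. by move=> Sa; rewrite -sub0r; apply: subringB => //; apply: subring0. Qed.

Lemma subringD a b : S a -> S b -> S (a + b).
Proof. by move=> Sa Sb; rewrite -[b]opprK; apply/subringB/subringN. Qed.

Lemma subringX n a : S a -> S (a ^+ n).
Proof.
move=> Sa; elim: n => [|n IHn]; first exact: subring1.
by rewrite exprS; apply: subringM.
Qed.

Lemma subring_nat n : S n%:R.
Proof.
elim: n => [|n IHn]; first exact: subring0.
by rewrite -natr1; apply: subringD => //; apply: subring1.
Qed.

Lemma subring_sum (I : Type) (r : seq I) (P : pred I) (F : I -> B) :
  (forall i, S (F i)) -> S (\sum_(i <- r | P i) F i).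
Proof. by move=> SF; elim/big_ind: _ => //; [apply: subring0|apply: subringD]. Qed.

Lemma gen_subalg_sub (A : comNzRingType) (iota : {rmorphism A -> B}) k
    (g : k.-tuple B) b :
  (forall a, S (iota a)) -> (forall i, S (tnth g i)) ->
  in_gen_subalg iota g b -> S b.
Proof.
move=> Siota Sg [h ->]; apply: subring_sum => m; apply: subringM => //.
rewrite /mmap1; elim/big_ind: _ => [||i _]; first exact: subring1.
  exact: subringM.
exact: subringX.
Qed.

End Subring.

Ltac subring rS := repeat first
  [ assumption | apply: (subringX rS) | apply: (subring_nat rS)
  | apply: (subringB rS) | apply: (subringD rS) | apply: (subringN rS)
  | apply: (subringM rS) ].

Section GenSubalg.

Variables (A B : comNzRingType) (iota : {rmorphism A -> B}).
Variables (k : nat) (g : k.-tuple B).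

Lemma gen_subalg_subring : is_subring (in_gen_subalg iota g).
Proof.
split=> [|_ _ [h1 ->] [h2 ->]|_ _ [h1 ->] [h2 ->]].
- by exists 1; rewrite rmorph1.
- by exists (h1 - h2); rewrite rmorphB.
- by exists (h1 * h2); rewrite rmorphM.
Qed.

Lemma gen_subalg_cst a : in_gen_subalg iota g (iota a).
Proof. by exists a%:MP; rewrite mmapC. Qed.

Lemma gen_subalg_gen i : in_gen_subalg iota g (tnth g i).
Proof. by exists 'X_i; rewrite mmapX mmap1U. Qed.

End GenSubalg.

(** On a monomial, [s - t] divides [s^i - t^i], and the quotients add up. Locating [q] in the
    subalgebra of [s], [t], [w] lets it be recovered later from these three. *)
Lemma mmap2_divided_difference (A B : comNzRingType)
    (iota : {rmorphism A -> B}) (s t w : B) (h : {mpoly A[2]}) :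
  exists2 q, in_gen_subalg iota [tuple s; t; w] q &
    mmap iota (tnth [tuple s; w]) h - mmap iota (tnth [tuple t; w]) h
      = (s - t) * q.
Proof.
have rS := gen_subalg_subring iota [tuple s; t; w].
have Ss : in_gen_subalg iota [tuple s; t; w] s by exact: (gen_subalg_gen _ _ 0).
have St : in_gen_subalg iota [tuple s; t; w] t by exact: (gen_subalg_gen _ _ 1).
have Sw : in_gen_subalg iota [tuple s; t; w] w by exact: (gen_subalg_gen _ _ 2).
elim/mpolyind: h => [|c m h _ _ [q Sq Eq]].
  by exists 0; [apply: subring0|rewrite !rmorph0 subrr mulr0].
(* The geometric quotient of [s^(m 0) - t^(m 0)] by [s - t]; for [m 0 = 0] the sum is empty, so the
   truncated predecessor is harmless. *)
pose r := \sum_(i < m ord0) s ^+ ((m ord0).-1 - i) * t ^+ i.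
exists (iota c * (r * w ^+ m 1) + q).
  have Sc := gen_subalg_cst iota [tuple s; t; w] c.
  have Sr : in_gen_subalg iota [tuple s; t; w] r.
    by apply: subring_sum => // i; subring rS.
  by subring rS.
rewrite !mmapD !mmapZ !mmapX /mmap1 !big_ord_recl !big_ord0.
rewrite !mulr1 (_ : lift ord0 ord0 = 1) /=; last exact/val_inj.
rewrite mulrDr -Eq !(tnth_nth 0) /=.
have -> : (s - t) * (iota c * (r * w ^+ m 1)) = iota c * ((s - t) * r * w ^+ m 1).
  by ring.
by rewrite /r -subrXX; ring.
Qed.

(* [k] is the divided difference of [Q2] between [v^2] and [- f w], and [g] is
   [Q2(- f w, w)]; the conditional memberships follow the order in which the
   subring is shown to contain these elements. *)
Lemma venereau_algebra (B : idomainType) (x y z u d q1 q2 g k : B) :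
  let p := y * u + z ^+ 2 in
  let v := x * z + y * p in
  let w := x ^+ 2 * u - 2%:R * x * z * p - y * p ^+ 2 in
  let f := y + x ^+ 2 * (v * q2 + x * q1) in
  x != 0 -> 2%:R * d = 1 -> q2 - g = (v ^+ 2 + f * w) * k ->
  exists z' u', forall S : B -> Prop, is_subring S ->
    S x -> S d -> (S f -> S w -> S g) -> (S v -> S w -> S q1 /\ S q2) ->
    (S f -> S v -> S w -> S k) ->
    S f -> S z' -> S u' -> [/\ S y, S z & S u].
Proof.
move=> p v w f x0 hd hk.
have x20 : x ^+ 2 != 0 by rewrite expf_neq0.
pose a := v * q2 + x * q1; pose b := - (d * w * g).
(* Chosen as [(p' - p) / x]: in [(f w + v'^2) / x^2] the terms [v w q2] of [w a] and
   [2 v b = - v w g] combine to [v w (q2 - g)], a multiple of [x^2]. *)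
pose c := w * q1 + x * (v * w * (p + w * a) * k + b ^+ 2).
pose p' := p + x * c; pose v' := v + x ^+ 2 * b.
pose z' := z + x * b - x * a * p' - y * c.
pose u' := u + 2%:R * c * z + 2%:R * b * p' - y * c ^+ 2 - a * p' ^+ 2.
have hvf : v ^+ 2 + f * w = x ^+ 2 * (p + w * a).
  by rewrite /f /a /w /v /p; ring.
have hb : 2%:R * b = - (w * g) by rewrite /b mulrN !mulrA hd mul1r.
have hp' : f * w + v' ^+ 2 = x ^+ 2 * p'.
  have -> : f * w + v' ^+ 2 = v ^+ 2 + f * w + x ^+ 2 * v * (2%:R * b) + x ^+ 4 * b ^+ 2.
    by rewrite /v'; ring.
  have hg : g = q2 - x ^+ 2 * (p + w * a) * k by rewrite -hvf -hk; ring.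
  by rewrite hvf hb hg /p' /c /a; ring.
(* The next three identities show that [p'], [v'], [w] are built from [f], [z'], [u'] exactly as
   [p], [v], [w] are from [y], [z], [u]. *)
have Ev : v' = x * z' + f * p'.
  by rewrite /v' /z' /f -/a /p' /v; ring.
have Ew : w = x ^+ 2 * u' - 2%:R * x * z' * p' - f * p' ^+ 2.
  have -> : 2%:R * x * z' * p' = 2%:R * (v' - f * p') * p' by rewrite Ev; ring.
  by rewrite /u' /v' /f -/a /p' /w /v; ring.
have Ep : p' = f * u' + z' ^+ 2.
  apply: (mulfI x20); rewrite -hp' Ew Ev; ring.
exists z', u' => S rS Sx Sd Sg Sq Sk Sf Sz' Su'.
have Sp' : S p' by rewrite Ep; subring rS.
have Sv' : S v' by rewrite Ev; subring rS.
have Sw : S w by rewrite Ew; subring rS.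
(* Since [g] depends only on [f] and [w], the correction [b] is available before [v]; it yields [v],
   then [q1], [q2], [k], hence [a] and [y]. *)
have Sb : S b by have := Sg Sf Sw; rewrite /b => ?; subring rS.
have Sv : S v by rewrite -(addrK (x ^+ 2 * b) v) -/v'; subring rS.
have [Sq1 Sq2] := Sq Sv Sw.
have Sk' := Sk Sf Sv Sw.
have Sa : S a by rewrite /a; subring rS.
have Sy : S y by rewrite -(addrK (x ^+ 2 * a) y) -/f; subring rS.
(* [c] involves [p], which is not yet known to lie in [S]; this rewrites [p + w a] through elements
   that are. *)
have Em : p + w * a = p' - 2%:R * b * v - x ^+ 2 * b ^+ 2.
  apply: (mulfI x20); rewrite -hvf.
  have -> : x ^+ 2 * (p' - 2%:R * b * v - x ^+ 2 * b ^+ 2)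
    = x ^+ 2 * p' - 2%:R * x ^+ 2 * b * v - x ^+ 4 * b ^+ 2 by ring.
  by rewrite -hp' /v'; ring.
have Sc : S c by rewrite /c Em; subring rS.
have Sz : S z.
  have -> : z = z' - x * b + x * a * p' + y * c by rewrite /z'; ring.
  by subring rS.
split=> //.
have -> : u = u' - 2%:R * c * z - 2%:R * b * p' + y * c ^+ 2 + a * p' ^+ 2.
  by rewrite /u'; ring.
by subring rS.
Qed.

Lemma venereau_generators (A K : comNzRingType) (B : idomainType)
    (iota : {rmorphism A -> B}) (iota0 : {rmorphism K -> B}) (x y z u d q1 q2 : B) :
  let p := y * u + z ^+ 2 in
  let v := x * z + y * p in
  let w := x ^+ 2 * u - 2%:R * x * z * p - y * p ^+ 2 in
  x != 0 -> 2%:R * d = 1 ->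
  in_gen_subalg iota [tuple v; w] q1 ->
  in_gen_subalg iota0 [tuple v ^+ 2; w] q2 ->
  let f := y + x ^+ 2 * (v * q2 + x * q1) in
  exists z' u', forall S : B -> Prop, is_subring S ->
    (forall a, S (iota a)) -> (forall a, S (iota0 a)) ->
    S x -> S d -> S f -> S z' -> S u' -> [/\ S y, S z & S u].
Proof.
move=> p v w x0 hd hq1 [h hq2] f.
(* With this [t], the factor [v^2 - t] of the divided difference is [v^2 + f w]. *)
pose t := - (f * w); pose g := mmap iota0 (tnth [tuple t; w]) h.
have [k hk Ek] := mmap2_divided_difference iota0 (v ^+ 2) t w h.
have Eg : q2 - g = (v ^+ 2 + f * w) * k by rewrite hq2 Ek /t opprK.
have [z' [u' gen]] := venereau_algebra x0 hd Eg.
exists z', u' => S rS Siota Siota0 Sx Sd; apply: gen => // {Sx Sd}.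
- move=> Sf Sw; have St : S t by subring rS.
  apply: (gen_subalg_sub rS Siota0 _ (ex_intro _ h erefl)).
  by case=> [[|[|//]] ?]; rewrite (tnth_nth 0).
- move=> Sv Sw; have Sv2 : S (v ^+ 2) by subring rS.
  split.
    apply: (gen_subalg_sub rS Siota _ hq1).
    by case=> [[|[|//]] ?]; rewrite (tnth_nth 0).
  apply: (gen_subalg_sub rS Siota0 _ (ex_intro _ h hq2)).
  by case=> [[|[|//]] ?]; rewrite (tnth_nth 0).
- move=> Sf Sv Sw; have St : S t by subring rS.
  have Sv2 : S (v ^+ 2) by subring rS.
  apply: (gen_subalg_sub rS Siota0 _ hk).
  by case=> [[|[|[|//]]] ?]; rewrite (tnth_nth 0).
Qed.

Lemma mpoly_subringT (A : comNzRingType) n (S : {mpoly A[n]} -> Prop) :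
  is_subring S -> (forall a, S a%:MP) -> (forall i, S 'X_i) -> forall q, S q.
Proof.
move=> rS Scst SX q; rewrite (mpolyE q); apply: subring_sum => // m.
rewrite -mul_mpolyC mpolyXE_id; apply: subringM => //.
elim/big_ind: _ => [||i _]; [exact: subring1|exact: subringM|exact: subringX].
Qed.

(** The constant [1/2] serves as [d], and [S] is taken to be the subalgebra generated by [f], [z'],
    [u']; containing the constants and [y], [z], [u], it is the whole ring. *)
Lemma venereau_coordinate (K : fieldType) (Q1 Q2 : {mpoly {poly K}[3]}) :
  (2%:R : K) != 0 ->
  in_gen_subalg (cst_Kx K) [tuple ven_v K; ven_w K] Q1 ->
  in_gen_subalg (cst_K K) [tuple ven_v K ^+ 2; ven_w K] Q2 ->
  is_coordinate (ven_y K + ven_x K *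
    (ven_x K ^+ 2 * Q1 + ven_x K * ven_v K * Q2)).
Proof.
move=> two_neq0 hQ1 hQ2.
have x0 : ven_x K != 0 by rewrite mpolyC_eq0 polyX_eq0.
have hd : 2%:R * cst_K K 2%:R^-1 = 1.
  by rewrite -(rmorph_nat (cst_K K)) -rmorphM mulfV // rmorph1.
have [z' [u' gen]] := @venereau_generators _ _ _ (cst_Kx K) (cst_K K)
  (ven_x K) (ven_y K) (ven_z K) (ven_u K) _ Q1 Q2 x0 hd hQ1 hQ2.
exists [tuple z'; u'].
have -> : ven_y K + ven_x K * (ven_x K ^+ 2 * Q1 + ven_x K * ven_v K * Q2)
  = ven_y K + ven_x K ^+ 2 * (ven_v K * Q2 + ven_x K * Q1).
  by move: (ven_x K) (ven_y K) (ven_v K) => x y v; ring.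
set f := ven_y K + _; set G := [tuple of _].
have rS := gen_subalg_subring (@mpolyC 3 {poly K}) G.
have Scst := gen_subalg_cst (@mpolyC 3 {poly K}) G.
have SG := gen_subalg_gen (@mpolyC 3 {poly K}) G.
have [] := gen _ rS Scst (fun a => Scst a%:P) (Scst 'X) (Scst _).
- exact: (SG 0).
- exact: (SG 1).
- exact: (SG 2).
move=> Sy Sz Su; apply: mpoly_subringT => // -[[|[|[|//]]] lt_i];
  by rewrite (bool_irrelevance lt_i isT).
Qed.

Theorem theorem13 (R : realType) (Q Q1 Q2 : {mpoly {poly R[i]}[3]})
    (hQ : in_gen_subalg (cst_Kx R[i]) [tuple ven_v R[i]; ven_w R[i]] Q)
    (hQ1 : in_gen_subalg (cst_Kx R[i]) [tuple ven_v R[i]; ven_w R[i]] Q1)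
    (hQ2 : in_gen_subalg (cst_K R[i]) [tuple ven_v R[i] ^+ 2; ven_w R[i]] Q2)
    (hQE : Q = ven_x R[i] ^+ 2 * Q1 + ven_x R[i] * ven_v R[i] * Q2) :
  is_coordinate (ven_y R[i] + ven_x R[i] * Q).
Proof.
rewrite hQE; apply: venereau_coordinate => //.
by rewrite Num.Theory.pnatr_eq0.
Qed.
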